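(* Let $\eta$ be a transverse section of the canonical bundle $K_M=\Lambda^{2,0}M$ whose zero set is $C$, let $\alpha$ be a transverse section of $\Lambda^{1,0}M$, and put $Z_\alpha:=\alpha^{-1}(0)$ and $\alpha_\eta:=\iota(\alpha^\sharp)\eta$. Let $W^+=\Lambda^{1,0}M\oplus\underline{\mathbb C}$, $W^-=\mathfrak{sl}(\Lambda^{1,0}M)$, and define $\psi:W^+\to W^-$ by $$\psi(\beta,f)=\alpha_\eta^\sharp\otimes\beta-\tfrac12\langle\beta,\alpha_\eta\rangle\,\mathrm{Id}+f\,\alpha^\sharp\otimes\alpha_\eta .$$ Let $\mathcal A=\mathcal A_\psi:E^+\to E^-$ be the associated perturbation (see context). Then $\psi$ is an isomorphism over $M\setminus(Z_\alpha\cup C)$ and vanishes on $Z_\alpha\cup C$. Hence the singular set of $\mathcal A$ is $Z_{\mathcal A}=Z_\alpha\cup C$, and $\mathcal A|_p=0$ for every $p\in Z_{\mathcal A}$. In particular, $$\ker(\mathcal A|_{Z_{\mathcal A}})=E^+|_{Z_{\mathcal A}}\qquad\text{and}\qquad\ker(\mathcal A^*|_{Z_{\mathcal A}})=E^-|_{Z_{\mathcal A}}.$$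
   Context: $(M,J)$ is a compact almost hermitian 4-manifold with a smooth embedded, possibly disconnected, $J$-holomorphic curve $C$ representing the canonical class. $\mathfrak{sl}(\Lambda^{1,0}M)$ is the bundle of trace-free complex-linear endomorphisms of $\Lambda^{1,0}M$. For $\beta\in\Lambda^{1,0}M$, $\beta^\sharp\in T^{1,0}M$ is the (conjugate-linear) metric dual, so $\gamma(\beta^\sharp)=\langle\gamma,\beta\rangle$ for $\gamma\in\Lambda^{1,0}M$, with $\langle\cdot,\cdot\rangle$ complex-linear in the first slot; $v\otimes\beta$ with $v\in T^{1,0}M$ denotes the endomorphism $\gamma\mapsto\gamma(v)\beta$ of $\Lambda^{1,0}M$. The canonical $\mathrm{spin}^c$ spinor bundle is $\mathbb S=\mathbb S^+\oplus\mathbb S^-$ with $\mathbb S^+=\Lambda^{0,0}M\oplus\Lambda^{0,2}M$, $\mathbb S^-=\Lambda^{0,1}M$; $\gamma$ denotes the chirality operator, $\gamma|_{\mathbb S^\pm}=\pm\mathrm{Id}$. Set $E^+=(\mathbb S^+\otimes W^+)\oplus(\mathbb S^-\otimes W^-)$, $E^-=(\mathbb S^+\otimes W^-)\oplus(\mathbb S^-\otimes W^+)$, and $$\mathcal A_\psi=\begin{bmatrix}\gamma\otimes\psi&0\\0&\gamma\otimes\psi^*\end{bmatrix}:E^+\to E^-.$$ The singular set of $\mathcal A$ is $Z_{\mathcal A}=\{x\in M:\ker\mathcal A_x\neq0\}$. *)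

(* Defs.v *)
From HB Require Import structures.
From mathcomp Require Import all_boot all_order all_algebra.
From mathcomp Require Import all_classical all_reals all_analysis.
From mathcomp Require Import complex.

Set Implicit Arguments.
Unset Strict Implicit.
Unset Printing Implicit Defensive.

Import Order.TTheory GRing.Theory Num.Theory.
Import numFieldNormedType.Exports.

Local Open Scope classical_set_scope.
Local Open Scope ring_scope.

(** * Smooth maps on open subsets of R^n *)

Fixpoint Ck (R : realType) (n : nat) (W : normedModType R) (k : nat)
    (U : set 'rV[R]_n) (f : 'rV[R]_n -> W) : Prop :=
  if k is k'.+1 then
    (forall x, U x -> differentiable f x) /\
    (forall v, Ck k' U (fun x => 'D_v f x))
  else forall x, U x -> {for x, continuous f}.

Definition smooth (R : realType) (n : nat) (W : normedModType R)
    (U : set 'rV[R]_n) (f : 'rV[R]_n -> W) : Prop :=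
  forall k, Ck k U f.

Definition smoothC (R : realType) (n a b : nat) (U : set 'rV[R]_n)
    (f : 'rV[R]_n -> 'M[R[i]]_(a, b)) : Prop :=
  forall i j, smooth U (fun x => complex.Re (f x i j) : R) /\
              smooth U (fun x => complex.Im (f x i j) : R).

Definition deriveC (R : realType) (n a b : nat)
    (f : 'rV[R]_n -> 'M[R[i]]_(a, b)) (x v : 'rV[R]_n) : 'M[R[i]]_(a, b) :=
  \matrix_(i, j) Complex ('D_v (fun y => complex.Re (f y i j) : R) x)
                         ('D_v (fun y => complex.Im (f y i j) : R) x).

(** * Smooth 4-manifolds *)

Record chart (R : realType) (M : Type) := Chart {
  cdom : set M;
  cmap : M -> 'rV[R]_4;
  cinv : 'rV[R]_4 -> M }.

Definition cimg (R : realType) (M : Type) (c : chart R M) : set 'rV[R]_4 :=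
  cmap c @` cdom c.

Definition is_chart (R : realType) (M : topologicalType) (c : chart R M) :=
  [/\ open (cdom c), open (cimg c),
      (forall x, cdom c x -> cinv c (cmap c x) = x),
      {within cdom c, continuous (cmap c)} &
      {within cimg c, continuous (cinv c)}].

Definition smooth_transition (R : realType) (M : Type) (c d : chart R M) :=
  smooth (cmap c @` (cdom c `&` cdom d)) (cmap d \o cinv c).

(** A smooth structure is given by an atlas together with a preferred chart at
    every point; since these preferred charts already cover, only they are
    recorded. *)
Record smooth_atlas (R : realType) (M : topologicalType) := SmoothAtlas {
  chart_at : M -> chart R M;
  chart_atP : forall p, is_chart (chart_at p);
  chart_at_dom : forall p, cdom (chart_at p) p;
  chart_at_transition :
    forall p q, smooth_transition (chart_at p) (chart_at q) }.

Definition smooth_chart (R : realType) (M : topologicalType)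
    (A : smooth_atlas R M) (c : chart R M) :=
  is_chart c /\ forall p, smooth_transition (chart_at A p) c /\
                          smooth_transition c (chart_at A p).

(** The tangent space at p is identified with R^4 by the preferred chart at p.
    Following the convention of [jacobian], vectors are rows and operators act
    on the right: the coordinates in a chart c of the tangent vector v at p are
    [v *m chart_jac A c p]. *)
Definition chart_jac (R : realType) (M : topologicalType)
    (A : smooth_atlas R M) (c : chart R M) (p : M) : 'M[R]_4 :=
  jacobian (cmap c \o cinv (chart_at A p)) (cmap (chart_at A p) p).

(** Complexified covectors are columns, [theta(v) = (v *m theta) 0 0], and
    bilinear forms are matrices, [w(u, v) = (u *m w *m v^T) 0 0]. Below are the
    components in the chart around q of a tensor field given by its components
    in the preferred charts. *)
Definition endo_in (R : realType) (M : topologicalType) (A : smooth_atlas R M)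
    (J : M -> 'M[R]_4) (q : M) (y : 'rV[R]_4) : 'M[R]_4 :=
  let x := cinv (chart_at A q) y in
  let P := chart_jac A (chart_at A q) x in
  invmx P *m J x *m P.

Definition form_in (R : realType) (M : topologicalType) (A : smooth_atlas R M)
    (g : M -> 'M[R]_4) (q : M) (y : 'rV[R]_4) : 'M[R]_4 :=
  let x := cinv (chart_at A q) y in
  let P := chart_jac A (chart_at A q) x in
  invmx P *m g x *m (invmx P)^T.

Definition toC (R : realType) (m n : nat) (A : 'M[R]_(m, n)) : 'M[R[i]]_(m, n) :=
  map_mx (real_complex R) A.

Definition covectorC_in (R : realType) (M : topologicalType)
    (A : smooth_atlas R M) (theta : M -> 'cV[R[i]]_4) (q : M) (y : 'rV[R]_4) :
    'cV[R[i]]_4 :=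
  let x := cinv (chart_at A q) y in
  let P := toC (chart_jac A (chart_at A q) x) in
  invmx P *m theta x.

Definition formC_in (R : realType) (M : topologicalType) (A : smooth_atlas R M)
    (w : M -> 'M[R[i]]_4) (q : M) (y : 'rV[R]_4) : 'M[R[i]]_4 :=
  let x := cinv (chart_at A q) y in
  let P := toC (chart_jac A (chart_at A q) x) in
  invmx P *m w x *m (invmx P)^T.

(** * Hermitian linear algebra *)

Section HermitianAlgebra.
Variable C : numClosedFieldType.

(** A sesquilinear form, complex-linear in the first slot. *)
Definition sform (V : vectType C) := V -> V -> C.

Definition adjoint_of (V W : vectType C) (hV : sform V) (hW : sform W)
    (f : 'Hom(V, W)) : set 'Hom(W, V) :=
  [set g | forall v w, hW (f v) w = hV v (g w)].

(** The hermitian adjoint; for positive definite forms [adjoint_of] has exactly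
    one element, so the default value is never used. *)
Definition adj (V W : vectType C) (hV : sform V) (hW : sform W)
    (f : 'Hom(V, W)) : 'Hom(W, V) := xget 0 (adjoint_of hV hW f).

Definition lftrace (V : vectType C) (f : 'End(V)) : C :=
  \sum_(i < \dim {:V}) coord (vbasis {:V}) i (f (vbasis {:V})`_i).

Lemma lftrace_is_linear (V : vectType C) :
  linear (@lftrace V : 'End(V) -> C^o).
Proof.
move=> a f g; rewrite /lftrace scaler_sumr -big_split /=.
by apply: eq_bigr => i _; rewrite add_lfunE scale_lfunE linearP.
Qed.
HB.instance Definition _ (V : vectType C) :=
  GRing.isLinear.Build C 'End(V) C^o *:%R (@lftrace V) (@lftrace_is_linear V).

(** The induced metrics on Hom spaces (Hilbert-Schmidt), on the dual, on direct
    sums and on the trivial line. *)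
Definition sform_hom (V W : vectType C) (hV : sform V) (hW : sform W) :
    sform 'Hom(V, W) :=
  fun f g => lftrace (adj hV hW g \o f)%VF.

Definition sform_triv : sform C^o := fun z w => (z : C) * (w : C)^*.

Definition sform_sum (V W : vectType C) (hV : sform V) (hW : sform W) :
    sform (V * W)%type :=
  fun u v => hV u.1 v.1 + hW u.2 v.2.

(** V (x) W is realised as Hom(V^*, W), the elementary tensor v (x) w being
    l |-> l(v) w; under this identification the Hilbert-Schmidt metric satisfies
    < v (x) w, v' (x) w' > = < v, v' > < w, w' >. *)
Definition tens (V W : vectType C) : vectType C := 'Hom('Hom(V, C^o), W).

Definition sform_tens (V W : vectType C) (hV : sform V) (hW : sform W) :
    sform (tens V W) :=
  sform_hom (sform_hom hV sform_triv) hW.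

Section TensMap.
Variables (V V' W W' : vectType C).

Definition dual_fun (a : 'Hom(V, V')) (l : 'Hom(V', C^o)) : 'Hom(V, C^o) :=
  (l \o a)%VF.

Lemma dual_fun_linear a : linear (dual_fun a).
Proof. by move=> c l m; rewrite /dual_fun comp_lfunDl comp_lfunZl. Qed.
HB.instance Definition _ a :=
  GRing.isLinear.Build C _ _ *:%R (dual_fun a) (dual_fun_linear a).

Definition tens_fun (a : 'Hom(V, V')) (b : 'Hom(W, W')) (t : tens V W) :
    tens V' W' := (b \o (t \o linfun (dual_fun a)))%VF.

Lemma tens_fun_linear a b : linear (tens_fun a b).
Proof.
move=> c s t; rewrite /tens_fun comp_lfunDl -comp_lfunZl.
by rewrite comp_lfunDr -comp_lfunZr.
Qed.
HB.instance Definition _ a b :=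
  GRing.isLinear.Build C (tens V W) (tens V' W') *:%R (tens_fun a b)
    (tens_fun_linear a b).

(** a (x) b *)
Definition tens_map (a : 'Hom(V, V')) (b : 'Hom(W, W')) :
  'Hom(tens V W, tens V' W') := linfun (tens_fun a b).

Definition diag_fun (a : 'Hom(V, V')) (b : 'Hom(W, W')) (u : V * W) : V' * W' :=
  (a u.1, b u.2).

Lemma diag_fun_linear a b : linear (diag_fun a b).
Proof. by move=> c u v; rewrite /diag_fun !linearP. Qed.
HB.instance Definition _ a b :=
  GRing.isLinear.Build C (V * W)%type (V' * W')%type *:%R (diag_fun a b)
    (diag_fun_linear a b).

(** The block-diagonal map diag(a, b). *)
Definition diag_map (a : 'Hom(V, V')) (b : 'Hom(W, W')) :
  'Hom((V * W)%type, (V' * W')%type) := linfun (diag_fun a b).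

End TensMap.

End HermitianAlgebra.

(** * The linear algebra of one tangent space *)

Record herm4 (R : realType) := Herm4 {
  hJ : 'M[R]_4;
  hg : 'M[R]_4;
  hJ2 : hJ *m hJ = - 1%:M;
  hg_sym : hg^T = hg;
  hg_pos : forall v : 'rV[R]_4, v != 0 -> 0 < (v *m hg *m v^T) 0 0;
  hg_compat : hJ *m hg *m hJ^T = hg }.

Section Fibre.
Variables (R : realType) (h : herm4 R).
Local Notation C := R[i].

Definition JC : 'M[C]_4 := toC (hJ h).
Definition giC : 'M[C]_4 := toC (invmx (hg h)).

Definition cbar m n (A : 'M[C]_(m, n)) : 'M[C]_(m, n) := map_mx Num.conj A.

(** theta o J = +-i theta for covectors of type (1,0), (0,1); an alternating form
    is of type (2,0), resp. (0,2), iff w(Jv, u) = +-i w(v, u). *)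
Definition L10 : {vspace 'cV[C]_4} := passmx.leigenspace (linfun (mulmx JC)) 'i.
Definition L01 : {vspace 'cV[C]_4} := passmx.leigenspace (linfun (mulmx JC)) (- 'i).

Definition alt2 : {vspace 'M[C]_(4, 4)} :=
  passmx.leigenspace (linfun (fun w : 'M[C]_(4, 4) => w^T : 'M[C]_(4, 4))) (- 1).
Definition L20 : {vspace 'M[C]_(4, 4)} :=
  (alt2 :&: passmx.leigenspace
              (linfun (mulmx JC : 'M[C]_(4, 4) -> 'M[C]_(4, 4))) 'i)%VS.
Definition L02 : {vspace 'M[C]_(4, 4)} :=
  (alt2 :&: passmx.leigenspace
              (linfun (mulmx JC : 'M[C]_(4, 4) -> 'M[C]_(4, 4))) (- 'i))%VS.

Lemma L_eigP (V : vectType C) (f : 'End(V)) (a : C) (v : V) :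
  reflect (f v = a *: v) (v \in passmx.leigenspace f a).
Proof.
rewrite memv_ker add_lfunE opp_lfunE scale_lfunE id_lfunE subr_eq0.
exact: eqP.
Qed.

(** The metrics induced on complex covectors and on complex 2-forms
    (normalised so that e^1 /\ e^2 has norm 1 when e^1, e^2 are orthonormal). *)
Definition cov_ip (s t : 'cV[C]_4) : C := (s^T *m giC *m cbar t) 0 0.
Definition form_ip (w t : 'M[C]_(4, 4)) : C :=
  2^-1 * \tr (w^T *m giC *m cbar t *m giC).

Definition sharp (b : 'cV[C]_4) : 'rV[C]_4 := (giC *m cbar b)^T.

Lemma sharpE (s b : 'cV[C]_4) : (sharp b *m s) 0 0 = cov_ip s b.
Proof.
transitivity ((sharp b *m s)^T 0 0); first by rewrite [RHS]mxE.
by rewrite trmx_mul trmxK mulmxA.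
Qed.

(** Tangent vectors of type (1,0). *)
Definition T10 : {vspace 'rV[C]_4} := passmx.leigenspace (linfun (mulmxr JC)) 'i.

Lemma sharp_T10 (b : subvs_of L10) : sharp (vsval b) \in T10.
Proof.
have /L_eigP := valP b; rewrite lfunE /= => Jb.
have gU : hg h \in unitmx.
  rewrite -row_free_unit -kermx_eq0; apply/rowV0P => v /sub_kermxP vg.
  apply/eqP/negPn/negP => /(hg_pos h).
  by rewrite vg mul0mx mxE ltxx.
have gJ : hg h *m (hJ h)^T = - (hJ h *m hg h).
  by rewrite -[in RHS](hg_compat h) !mulmxA hJ2 !mulNmx mul1mx opprK.
have Jg : (hJ h)^T *m invmx (hg h) = - (invmx (hg h) *m hJ h).
  rewrite -[LHS](mulKmx gU) (mulmxA (hg h)) gJ mulNmx mulmxN.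
  by rewrite mulmxK.
have Jbar : JC *m cbar (vsval b) = - ('i *: cbar (vsval b)).
  have -> : JC = cbar JC.
    by apply/matrixP => i j; rewrite !mxE; apply/esym; exact: conjc_real.
  rewrite /cbar -map_mxM Jb map_mxZ /=.
  by rewrite conjCi scaleNr.
apply/L_eigP; rewrite lfunE /= /sharp -linearZ /=.
rewrite -[JC]trmxK -trmx_mul; congr (_^T).
rewrite mulmxA [JC^T *m _](_ : _ = - (giC *m JC)).
  by rewrite mulNmx -mulmxA Jbar mulmxN opprK scalemxAr.
by rewrite /giC /JC /toC map_trmx -map_mxM Jg map_mxN map_mxM.
Qed.

Definition contract_cov (v : 'rV[C]_4) (w : 'M[C]_(4, 4)) : 'cV[C]_4 :=
  (v *m w)^T.

Lemma contract_covP (v : 'rV[C]_4) (w : subvs_of L20) :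
  contract_cov v (vsval w) \in L10.
Proof.
have /memv_capP[/L_eigP] := valP w.
rewrite lfunE /= scaleN1r => wT /L_eigP; rewrite lfunE /= => wJ.
apply/L_eigP; rewrite lfunE /= /contract_cov trmx_mul wT.
by rewrite mulNmx mulmxN mulmxA wJ -scalemxAl scalerN.
Qed.

Definition contract (v : 'rV[C]_4) (w : subvs_of L20) : subvs_of L10 :=
  Subvs (contract_covP v w).

(** v (x) b : gamma |-> gamma(v) b *)
Definition rank1_fun (v : 'rV[C]_4) (b c : subvs_of L10) : subvs_of L10 :=
  (v *m vsval c) 0 0 *: b.

Lemma rank1_fun_linear v b : linear (rank1_fun v b).
Proof.
move=> a c d; rewrite /rank1_fun [vsval _]linearP mulmxDr -scalemxAr !mxE.
by rewrite scalerDl scalerA.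
Qed.
HB.instance Definition _ v b :=
  GRing.isLinear.Build C _ _ *:%R (rank1_fun v b) (rank1_fun_linear v b).

Definition rank1 (v : 'rV[C]_4) (b : subvs_of L10) : 'End(subvs_of L10) :=
  linfun (rank1_fun v b).

Lemma lftrace_rank1 (v : 'rV[C]_4) (b : subvs_of L10) :
  lftrace (rank1 v b) = (v *m vsval b) 0 0.
Proof.
rewrite [in RHS](coord_vbasis (memvf b)) linear_sum mulmx_sumr summxE.
apply: eq_bigr => i _; rewrite lfunE /= /rank1_fun !linearZ /= [in RHS]mxE.
by rewrite mulrC.
Qed.

Lemma dim_L10 : \dim {: subvs_of L10} = 2.
Proof.
pose e := vbasis {: subvs_of L10}.
pose P : 'M[C]_4 := 2^-1 *: (1%:M - 'i *: JC).
have J2 : JC *m JC = - 1%:M.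
  by rewrite /JC /toC -map_mxM hJ2 map_mxN map_mx1.
have two0 : (2 : C) != 0 by rewrite pnatr_eq0.
have PL (v : 'cV[C]_4) : P *m v \in L10.
  apply/L_eigP; rewrite lfunE /= mulmxA scalemxAl; congr (_ *m _).
  rewrite /P -scalemxAr scalerA ['i * _]mulrC -scalerA; congr (_ *: _).
  rewrite mulmxBr mulmx1 -scalemxAr J2 scalerBr scalerA -expr2 sqrCi.
  by rewrite scalerN scaleN1r !opprK addrC.
have PK (v : subvs_of L10) : P *m vsval v = vsval v.
  have /L_eigP := valP v; rewrite lfunE /= => Jv.
  rewrite /P -scalemxAl mulmxBl mul1mx -scalemxAl Jv scalerA -expr2 sqrCi.
  by rewrite scaleN1r opprK -mulr2n -[vsval v *+ 2]scaler_nat scalerA mulVf ?scale1r.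
pose B : 'M[C]_(4, \dim {: subvs_of L10}) := \matrix_(a, i) vsval e`_i a 0.
pose Q : 'M[C]_(\dim {: subvs_of L10}, 4) :=
  \matrix_(i, a) coord e i (vsproj L10 (P *m delta_mx a 0)).
have BQ : B *m Q = P.
  apply/matrixP => a b; rewrite mxE.
  transitivity ((P *m (delta_mx b 0 : 'cV_4)) a 0); last first.
    by rewrite -colE mxE.
  rewrite -[P *m _](vsprojK (PL _)).
  rewrite [in RHS](coord_vbasis (memvf (vsproj L10 _))) linear_sum summxE.
  by apply: eq_bigr => i _; rewrite [in LHS]mxE [X in _ * X]mxE linearZ mxE mulrC.
have QB : Q *m B = 1%:M.
  apply/matrixP => i j; rewrite mxE.
  transitivity (coord e i e`_j); last first.
    by rewrite coord_free ?(basis_free (vbasisP _)) // mxE eq_sym.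
  rewrite -[e`_j in RHS]vsvalK -PK.
  have -> : vsval e`_j = \sum_a B a j *: (delta_mx a 0 : 'cV[C]_4).
    apply/matrixP => a b; rewrite summxE (bigD1 a) //= !mxE !ord1 eqxx mulr1.
    rewrite big1 ?addr0 // => c ca; rewrite eq_sym in ca.
    by rewrite !mxE (negPf ca) mulr0.
  rewrite mulmx_sumr !linear_sum; apply: eq_bigr => a _ /=.
  by rewrite -scalemxAr !linearZ /= mulrC !mxE.
have : (\dim {: subvs_of L10})%:R = \tr P.
  by rewrite -BQ mxtrace_mulC QB mxtrace1.
rewrite /P linearZ /= linearB /= linearZ /= mxtrace1.
have trJ : (\tr JC)^* = \tr JC by rewrite /JC /toC trace_map_mx; exact: conjc_real.
move=> dE; have := congr1 Num.conj dE.
rewrite rmorph_nat rmorphM rmorphB rmorphM fmorphV !rmorph_nat /= conjCi trJ.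
rewrite mulNr opprK => dE'.
have : (\dim {: subvs_of L10})%:R + (\dim {: subvs_of L10})%:R = 4 :> C.
  rewrite {1}dE dE' -mulrDr addrACA addNr addr0 -mulr2n -(mulr_natl (4 : C) 2).
  by rewrite mulKf.
by move/eqP; rewrite -natrD eqr_nat addnn -[4%N]/(2%N.*2) => /eqP/double_inj.
Qed.

Lemma lftrace_id : lftrace (\1%VF : 'End(subvs_of L10)) = 2.
Proof.
rewrite /lftrace (eq_bigr (fun=> 1)) => [|i _].
  by rewrite sumr_const card_ord dim_L10.
by rewrite id_lfunE coord_free ?eqxx ?(basis_free (vbasisP _)).
Qed.

Lemma contract_self (v : 'rV[C]_4) (w : subvs_of L20) :
  (v *m vsval (contract v w)) 0 0 = 0.
Proof.
have /memv_capP[/L_eigP wT _] := valP w.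
rewrite lfunE /= scaleN1r in wT.
rewrite /contract /= /contract_cov trmx_mul mulmxA wT mulmxN mulNmx mxE.
set s := (v *m vsval w *m v^T) 0 0.
have sN : s = - s.
  rewrite {1}/s -[_ *m _ *m _]trmxK mxE !trmx_mul trmxK mulmxA wT.
  by rewrite mulmxN mulNmx mxE.
move/eqP: sN; rewrite -addr_eq0 -mulr2n mulrn_eq0 /= => /eqP ->.
exact: oppr0.
Qed.

Definition sl10 : {vspace 'End(subvs_of L10)} :=
  lker (linfun (fun f : 'End(subvs_of L10) => lftrace f : C^o)).

Definition Wplus : vectType C := (subvs_of L10 * C^o)%type.
Definition Wminus : vectType C := subvs_of sl10.
Definition Splus : vectType C := (C^o * subvs_of L02)%type.
Definition Sminus : vectType C := subvs_of L01.

Section Psi.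
Variables (eta : subvs_of L20) (alpha : subvs_of L10).

Definition alpha_eta : subvs_of L10 := contract (sharp (vsval alpha)) eta.

Definition psi_fun (w : Wplus) : 'End(subvs_of L10) :=
  rank1 (sharp (vsval alpha_eta)) w.1
  - (2^-1 * cov_ip (vsval w.1) (vsval alpha_eta)) *: \1%VF
  + (w.2 : C) *: rank1 (sharp (vsval alpha)) alpha_eta.

Lemma psi_fun_sl (w : Wplus) : psi_fun w \in sl10.
Proof.
rewrite memv_ker lfunE /= /psi_fun.
rewrite !linearD linearN !linearZ /= !lftrace_rank1 lftrace_id sharpE.
rewrite contract_self scaler0 addr0 -[_ *: _]/(_ * _) mulrN mulrAC mulVf.
  by rewrite mul1r subrr.
by rewrite pnatr_eq0.
Qed.

Lemma psi_fun_linear : linear psi_fun.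
Proof.
have rankP v a b c : rank1 v (a *: b + c) = a *: rank1 v b + rank1 v c.
  apply/lfunP => d; rewrite add_lfunE scale_lfunE !lfunE /= /rank1_fun.
  by rewrite scalerDr !scalerA mulrC.
have ipP a s t u : cov_ip (a *: s + t) u = a * cov_ip s u + cov_ip t u.
  by rewrite /cov_ip linearP /= !mulmxDl -!scalemxAl !mxE.
move=> a w z; rewrite /psi_fun /= rankP ipP mulrDr !scalerDl opprD.
rewrite [X in X + _ = _]addrACA [LHS]addrACA; congr (_ + _).
by rewrite scalerDr scalerBr !scalerA mulrCA.
Qed.

Definition psi_sl (w : Wplus) : Wminus := Subvs (psi_fun_sl w).

Lemma psi_sl_linear : linear psi_sl.
Proof. by move=> a w z; apply/val_inj; exact: psi_fun_linear. Qed.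
HB.instance Definition _ :=
  GRing.isLinear.Build C Wplus Wminus *:%R psi_sl psi_sl_linear.

Definition psi : 'Hom(Wplus, Wminus) := linfun psi_sl.

Lemma psiE (w : Wplus) : vsval (psi w) = psi_fun w.
Proof. by rewrite lfunE. Qed.

End Psi.

Definition ip_L10 : sform (subvs_of L10) := fun s t => cov_ip (vsval s) (vsval t).
Definition ip_Wplus : sform Wplus := sform_sum ip_L10 (@sform_triv C).
Definition ip_Wminus : sform Wminus :=
  fun f k => sform_hom ip_L10 ip_L10 (vsval f) (vsval k).
Definition ip_Splus : sform Splus :=
  sform_sum (@sform_triv C) (fun s t => form_ip (vsval s) (vsval t)).
Definition ip_Sminus : sform Sminus := fun s t => cov_ip (vsval s) (vsval t).

Definition Eplus : vectType C := (tens Splus Wplus * tens Sminus Wminus)%type.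
Definition Eminus : vectType C := (tens Splus Wminus * tens Sminus Wplus)%type.
Definition ip_Eplus : sform Eplus :=
  sform_sum (sform_tens ip_Splus ip_Wplus) (sform_tens ip_Sminus ip_Wminus).
Definition ip_Eminus : sform Eminus :=
  sform_sum (sform_tens ip_Splus ip_Wminus) (sform_tens ip_Sminus ip_Wplus).

(** The chirality operator on S^+ and on S^-. *)
Definition chir_plus : 'End(Splus) := \1%VF.
Definition chir_minus : 'End(Sminus) := - \1%VF.

Definition perturbation (f : 'Hom(Wplus, Wminus)) : 'Hom(Eplus, Eminus) :=
  diag_map (tens_map chir_plus f)
           (tens_map chir_minus (adj ip_Wplus ip_Wminus f)).

End Fibre.

(** * Almost hermitian 4-manifolds and their bundles *)

Record almost_hermitian (R : realType) (M : topologicalType)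
    (A : smooth_atlas R M) := AlmostHermitian {
  herm_at :> M -> herm4 R;
  hJ_smooth : forall q,
    smooth (cimg (chart_at A q)) (endo_in A (fun p => hJ (herm_at p)) q);
  hg_smooth : forall q,
    smooth (cimg (chart_at A q)) (form_in A (fun p => hg (herm_at p)) q) }.

Section Bundles.
Variables (R : realType) (M : topologicalType) (A : smooth_atlas R M).
Variable H : almost_hermitian A.

Definition section10 := forall p, subvs_of (L10 (H p)).
Definition section20 := forall p, subvs_of (L20 (H p)).

Definition local10 (s : section10) : M -> 'rV[R]_4 -> 'cV[R[i]]_4 :=
  covectorC_in A (fun p => vsval (s p)).
Definition local20 (s : section20) : M -> 'rV[R]_4 -> 'M[R[i]]_4 :=
  formC_in A (fun p => vsval (s p)).

Definition smooth10 (s : section10) :=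
  forall q, smoothC (cimg (chart_at A q)) (local10 s q).
Definition smooth20 (s : section20) :=
  forall q, smoothC (cimg (chart_at A q)) (local20 s q).

(** The derivative at p of the local components. At a zero of s this is the
    intrinsic derivative T_pM -> E_p of the section: it does not depend on the
    trivialisation, it takes values in the fibre E_p, and no change of frame is
    involved because the chart used is the preferred chart at p. *)
Definition D10 (s : section10) (p : M) (v : 'rV[R]_4) : 'cV[R[i]]_4 :=
  deriveC (local10 s p) (cmap (chart_at A p) p) v.
Definition D20 (s : section20) (p : M) (v : 'rV[R]_4) : 'M[R[i]]_4 :=
  deriveC (local20 s p) (cmap (chart_at A p) p) v.

Definition transverse10 (s : section10) := forall p, s p = 0 ->
  forall b : subvs_of (L10 (H p)), exists v, D10 s p v = vsval b.
Definition transverse20 (s : section20) := forall p, s p = 0 ->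
  forall b : subvs_of (L20 (H p)), exists v, D20 s p v = vsval b.

(** ** Embedded J-holomorphic curves *)

Definition slice_chart (S : set M) (c : chart R M) :=
  smooth_chart A c /\
  forall x, cdom c x -> (S x <-> forall i : 'I_4, (2 <= i)%N -> cmap c x 0 i = 0).

Definition embedded_surface (S : set M) :=
  forall p, S p -> exists2 c, slice_chart S c & cdom c p.

Definition tangent_to (S : set M) (p : M) (v : 'rV[R]_4) :=
  exists c, [/\ slice_chart S c, cdom c p &
    forall i : 'I_4, (2 <= i)%N -> (v *m chart_jac A c p) 0 i = 0].

Definition J_holomorphic_curve (S : set M) :=
  [/\ closed S, embedded_surface S &
      forall p v, S p -> tangent_to S p v -> tangent_to S p (v *m hJ (H p))].

(** ** Orientations

    An oriented-frame predicate [ori] gives for each p the pairs (v, w) that form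
    a positively oriented basis of the tangent plane at p. *)

Definition J_oriented (S : set M) (p : M) (v w : 'rV[R]_4) :=
  [/\ tangent_to S p v, v != 0 &
      exists a b : R, 0 < b /\ w = a *: v + b *: (v *m hJ (H p))].

Definition frame (v1 v2 v3 v4 : 'rV[R]_4) : 'M[R]_4 :=
  \matrix_(i < 4) [:: v1; v2; v3; v4]`_i.

Definition J_positive (p : M) (v1 v2 v3 v4 : 'rV[R]_4) :=
  let J := hJ (H p) in
  exists u1 u2, 0 < \det (frame u1 (u1 *m J) u2 (u2 *m J)) *
                    \det (frame v1 v2 v3 v4).

(** The orientation of the zero set of a transverse section s of K_M: the normal
    bundle is oriented by its isomorphism D s with the complex line K_M, and
    T_pM by J. *)
Definition zero_oriented (s : section20) (p : M) (v w : 'rV[R]_4) :=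
  D20 s p v = 0 /\ D20 s p w = 0 /\
  exists n1 n2 (z : R[i]),
    [/\ 0 < complex.Im z, D20 s p n2 = z *: D20 s p n1 &
        J_positive p v w n1 n2].

(** ** Singular chains

    A singular n-simplex is a function on R^(n+1), regarded through its
    restriction to the standard simplex; a chain is a formal integral
    combination, regarded through its coefficients. *)

Definition simplex (n : nat) : set 'rV[R]_n.+1 :=
  [set t | (forall i, 0 <= t 0 i) /\ \sum_i t 0 i = 1].

Definition face (n : nat) (i : 'I_n.+2) (t : 'rV[R]_n.+1) : 'rV[R]_n.+2 :=
  \row_j (if unlift i j is Some k then t 0 k else 0).

Definition chain (n : nat) := seq (int * ('rV[R]_n.+1 -> M)).

Definition coef (n : nat) (c : chain n) (tau : 'rV[R]_n.+1 -> M) : int :=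
  \sum_(s <- c | `[< forall t, simplex t -> s.2 t = tau t >]) s.1.

Definition bdry (n : nat) (c : chain n.+1) : chain n :=
  [seq ((-1) ^+ nat_of_ord i * s.1, s.2 \o face i) | s <- c, i <- enum 'I_n.+2].

Definition chain_in (n : nat) (S : set M) (c : chain n) :=
  all (fun s => `[< {within @simplex n, continuous s.2} /\
                    s.2 @` @simplex n `<=` S >]) c.

Definition homologous (n : nat) (S : set M) (c d : chain n) :=
  exists2 b : chain n.+1, chain_in S b &
    forall tau, coef (bdry b) tau = coef c tau - coef d tau.

(** A positively oriented embedded 2-simplex in S through p. *)
Definition oriented_simplex (S : set M) (ori : M -> 'rV[R]_4 -> 'rV[R]_4 -> Prop)
    (p : M) (sigma : 'rV[R]_3 -> M) :=
  [/\ chain_in (n := 2) S [:: (1, sigma)],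
      {in @simplex 2 &, injective sigma} &
      exists2 t : 'rV[R]_3, (forall i, 0 < t 0 i) /\ simplex t /\ sigma t = p &
        let f := cmap (chart_at A p) \o sigma in
        let e i : 'rV[R]_3 := delta_mx 0 i in
        differentiable f t /\
        ori p ('D_(e 1 - e 0) f t) ('D_(e 2%:R - e 0) f t)].

(** z is a singular cycle representing the fundamental class of the closed
    surface S oriented by [ori]: at each point p it induces the orientation
    generator of H_2(S, S \ p). *)
Definition fundamental_cycle (S : set M)
    (ori : M -> 'rV[R]_4 -> 'rV[R]_4 -> Prop) (z : chain 2) :=
  [/\ chain_in S z, (forall tau, coef (bdry z) tau = 0) &
      forall p, S p -> exists sigma (r : chain 2),
        [/\ oriented_simplex S ori p sigma, chain_in (S `\ p) r &
            homologous S z ((1, sigma) :: r)]].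

(** The canonical class is the Poincare dual of c_1(K_M), i.e. the homology class
    of the zero set of a transverse section of K_M. *)
Definition represents_canonical_class (S : set M) :=
  exists s : section20, [/\ smooth20 s, transverse20 s &
    exists zS zs : chain 2,
      [/\ fundamental_cycle S (J_oriented S) zS,
          fundamental_cycle [set p | s p = 0] (zero_oriented s) zs &
          homologous [set: M] zS zs]].

(** ** The perturbation *)

Definition psi_at (eta : section20) (alpha : section10) (p : M) :
    'Hom(Wplus (H p), Wminus (H p)) := psi (eta p) (alpha p).

Definition A_at (eta : section20) (alpha : section10) (p : M) :
    'Hom(Eplus (H p), Eminus (H p)) := perturbation (psi_at eta alpha p).

Definition A_adj_at (eta : section20) (alpha : section10) (p : M) :
    'Hom(Eminus (H p), Eplus (H p)) :=
  adj (@ip_Eplus R (H p)) (@ip_Eminus R (H p)) (A_at eta alpha p).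

Definition singular_set (eta : section20) (alpha : section10) : set M :=
  [set p | lker (A_at eta alpha p) != 0%VS].

End Bundles.

(* Main.v *)
(** Everything happens in one fibre. When [alpha] or [eta] vanishes, so do
    [alpha_eta] and [psi]. Otherwise [alpha_eta] is nonzero, since a nonzero
    alternating form of type (2,0) on a plane is nondegenerate, and it is
    orthogonal to [alpha]. Evaluating [psi (beta, f) = 0] on [alpha_eta] makes
    [beta] a multiple of [alpha_eta], and pairing with [alpha_eta] gives
    [<beta, alpha_eta> = <beta, alpha_eta> / 2]; hence [beta = 0], and evaluating on
    [alpha] gives [f = 0]. Both bundles have rank 3, so [psi] is an isomorphism.
    Hermitian adjoints behave as expected once the metrics on Hom spaces, tensor
    products and direct sums are known to be positive definite. *)

Require Import Defs.
From HB Require Import structures.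
From mathcomp Require Import all_boot all_order all_algebra.
From mathcomp Require Import all_classical all_reals all_analysis.
From mathcomp Require Import complex zify.

Set Implicit Arguments.
Unset Strict Implicit.
Unset Printing Implicit Defensive.

Import Order.TTheory GRing.Theory Num.Theory.
Import numFieldNormedType.Exports.

Local Open Scope classical_set_scope.
Local Open Scope ring_scope.

(** * Positive definite hermitian forms and Parseval frames *)

Section InnerProducts.
Variable C : numClosedFieldType.

(** An [sform] is a bare function, so its hermitian properties are recorded separately;
    antilinearity in the second slot follows from the first two fields. *)
Record inner (V : vectType C) (h : sform V) : Prop := Inner {
  inner_lin : forall a u v w, h (a *: u + v) w = a * h u w + h v w;
  inner_conj : forall u v, h u v = (h v u)^*;
  inner_gt0 : forall v, v != 0 -> 0 < h v v }.

Section Theory.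
Variables (V : vectType C) (h : sform V) (ih : inner h).

Lemma inner0l w : h 0 w = 0.
Proof.
have := inner_lin ih 1 0 0 w; rewrite scale1r add0r mul1r => /eqP.
by rewrite -subr_eq subrr => /eqP.
Qed.

Lemma innerDl u v w : h (u + v) w = h u w + h v w.
Proof. by rewrite -{1}[u]scale1r (inner_lin ih) mul1r. Qed.

Lemma innerZl a u w : h (a *: u) w = a * h u w.
Proof. by rewrite -[a *: u]addr0 (inner_lin ih) inner0l addr0. Qed.

Lemma innerNl u w : h (- u) w = - h u w.
Proof. by rewrite -scaleN1r innerZl mulN1r. Qed.

Lemma inner0r u : h u 0 = 0.
Proof. by rewrite (inner_conj ih) inner0l conjC0. Qed.

Lemma innerDr u v w : h u (v + w) = h u v + h u w.
Proof. by rewrite !(inner_conj ih u) innerDl rmorphD. Qed.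

Lemma innerZr a u w : h u (a *: w) = a^* * h u w.
Proof. by rewrite !(inner_conj ih u) innerZl rmorphM. Qed.

Lemma innerNr u w : h u (- w) = - h u w.
Proof. by rewrite !(inner_conj ih u) innerNl rmorphN. Qed.

Lemma inner_suml I (r : seq I) (F : I -> V) w :
  h (\sum_(i <- r) F i) w = \sum_(i <- r) h (F i) w.
Proof. exact: (big_morph (h^~ w) (fun u v => innerDl u v w) (inner0l w)). Qed.

Lemma inner_sumr I (r : seq I) (F : I -> V) u :
  h u (\sum_(i <- r) F i) = \sum_(i <- r) h u (F i).
Proof. exact: (big_morph (h u) (innerDr u) (inner0r u)). Qed.

Lemma inner_ge0 v : 0 <= h v v.
Proof.
by have [->|/(inner_gt0 ih)/ltW//] := eqVneq v 0; rewrite inner0l.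
Qed.

Lemma inner_eq0 v : h v v = 0 -> v = 0.
Proof.
by move=> hv; apply/eqP/negPn/negP => /(inner_gt0 ih); rewrite hv ltxx.
Qed.

(** A Parseval frame of [U]: used in place of an orthonormal basis, because no
    independence of the vectors of [s] is ever needed. *)
Definition parseval (U : {vspace V}) (s : seq V) :=
  forall v, v \in U -> v = \sum_(e <- s) h v e *: e.

(** Gram-Schmidt along the list: the component [u] of [x] orthogonal to the span of [X] is discarded
    if it is zero, and otherwise normalised and added to the frame. *)
Lemma parseval_span (X : seq V) :
  exists s, {subset s <= <<X>>%VS} /\ parseval <<X>> s.
Proof.
elim: X => [|x X [s [sX ps]]].
  exists [::]; split=> // v; rewrite span_nil memv0 => /eqP->.
  by rewrite big_nil.
have subX v : v \in <<X>>%VS -> v \in <<x :: X>>%VS.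
  by rewrite span_cons; apply/subvP/addvSr.
have xX : x \in <<x :: X>>%VS by rewrite memv_span ?mem_head.
pose y := \sum_(e <- s) h x e *: e; pose u := x - y.
have yX : y \in <<X>>%VS.
  by rewrite /y big_seq; apply: memv_suml => e /sX; apply: memvZ.
have uX v : v \in <<X>>%VS -> h v u = 0.
  move=> vX; rewrite innerDr innerNr inner_sumr [in h v x](ps v vX).
  rewrite inner_suml -sumrB big1 // => e _.
  by rewrite innerZl innerZr -(inner_conj ih) mulrC subrr.
have xE : x = y + u by rewrite addrC subrK.
(* The old frame computes the orthogonal projection to the span of [X], which sends [x] to [y]. *)
have yE a z : z \in <<X>>%VS ->
    a *: y + z = \sum_(e <- s) h (a *: x + z) e *: e.
  move=> /ps zX; rewrite [in LHS]zX /y scaler_sumr -big_split /=.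
  by apply: eq_bigr => e _; rewrite innerDl innerZl scalerDl scalerA.
have [u0|u_neq0] := eqVneq u 0.
  exists s; split=> [e /sX /subX//|v].
  rewrite span_cons => /memv_addP [w /vlineP [a ->] [z zX ->]].
  by rewrite -yE // [in LHS]xE u0 addr0.
pose r := sqrtC (h u u).
have r_neq0 : r != 0 by rewrite sqrtC_eq0; apply: lt0r_neq0; exact: inner_gt0.
have rJ : (r^-1)^* = r^-1.
  by apply: CrealP; rewrite ger0_real // invr_ge0 sqrtC_ge0 inner_ge0.
exists (r^-1 *: u :: s); split.
  move=> e; rewrite inE => /predU1P [->|/sX /subX//].
  by rewrite memvZ // memvB // subX.
move=> v; rewrite span_cons => /memv_addP [w /vlineP [a ->] [z zX ->]].
have xu : h (a *: x + z) u = a * r ^+ 2.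
  rewrite innerDl innerZl (uX z) // [in h x u]xE innerDl uX //.
  by rewrite add0r addr0 sqrtCK.
rewrite big_cons innerZr xu rJ -yE // scalerA.
have -> : r^-1 * (a * r ^+ 2) * r^-1 = a.
  by rewrite -mulrA expr2 [a * _]mulrA mulfK // mulrCA mulVf ?mulr1.
by rewrite [in LHS]xE scalerDr addrAC addrC.
Qed.

Lemma parseval_exists : exists s, forall v, v = \sum_(e <- s) h v e *: e.
Proof.
have [s [_ ps]] := parseval_span (vbasis {:V}).
by exists s => v; apply: ps; rewrite (span_basis (vbasisP _)) memvf.
Qed.

(** Expanding basis vectors in the frame, or images of frame vectors in the basis, leads to the same
    double sum. The trace defined through [vbasis] can thus be computed in any frame. *)
Lemma lftrace_parseval s (f : 'End(V)) :
  (forall v, v = \sum_(e <- s) h v e *: e) -> lftrace f = \sum_(e <- s) h (f e) e.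
Proof.
move=> ps; pose b := vbasis {:V}.
transitivity (\sum_(i < \dim {:V}) \sum_(e <- s) coord b i (f e) * h b`_i e).
  apply: eq_bigr => i _; rewrite [in LHS](ps b`_i) !linear_sum /=.
  by apply: eq_bigr => e _; rewrite !linearZ /= mulrC.
rewrite exchange_big; apply: eq_bigr => e _ /=.
rewrite [in RHS](coord_vbasis (memvf (f e))) inner_suml.
by apply: eq_bigr => i _; rewrite innerZl.
Qed.

End Theory.

(** * Adjoints and the metrics on Hom spaces, sums and tensor products *)

Section Adjoint.
Variables (V W : vectType C) (hV : sform V) (hW : sform W).
Hypotheses (iV : inner hV) (iW : inner hW).

Lemma adj_exists (f : 'Hom(V, W)) : exists g, adjoint_of hV hW f g.
Proof.
have [s ps] := parseval_exists iV.
pose g w := \sum_(e <- s) (hW (f e) w)^* *: e.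
have g_lin : linear g.
  move=> a u v; rewrite /g scaler_sumr -big_split; apply: eq_bigr => e _ /=.
  by rewrite (innerDr iW) (innerZr iW) rmorphD rmorphM /= conjCK scalerDl scalerA.
pose gl := GRing.isLinear.Build _ _ _ _ g g_lin.
pose G : {linear W -> V} := HB.pack g gl.
exists (linfun G) => v w; rewrite lfunE /= /g (inner_sumr iV).
rewrite [in LHS](ps v) linear_sum (inner_suml iW); apply: eq_bigr => e _.
by rewrite linearZ /= (innerZl iW) (innerZr iV) conjCK mulrC.
Qed.

(** By [adj_exists] the set of adjoints is inhabited, so [xget] returns one of its members and not
    the default 0. *)
Lemma adjP (f : 'Hom(V, W)) v w : hW (f v) w = hV v (adj hV hW f w).
Proof.
have [g fg] := adj_exists f.
by rewrite /adj; case: xgetP => [k _ -> //|/(_ g)].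
Qed.

(** As [adj] is obtained by choice, this rests on its defining identity, which makes each value of
    the adjoint of 0 orthogonal to itself. *)
Lemma adj0 : adj hV hW 0 = 0.
Proof.
apply/lfunP => w; rewrite zero_lfunE; apply: (inner_eq0 iV).
by rewrite -adjP zero_lfunE (inner0l iW).
Qed.

Lemma sform_homE s : (forall v, v = \sum_(e <- s) hV v e *: e) ->
  forall f g, sform_hom hV hW f g = \sum_(e <- s) hW (f e) (g e).
Proof.
move=> ps f g; rewrite /sform_hom (lftrace_parseval iV _ ps).
apply: eq_bigr => e _; rewrite comp_lfunE (inner_conj iV) -adjP.
by rewrite -(inner_conj iW).
Qed.

(** By [sform_homE] the square norm of [f] is the sum of the square norms of its values on a frame;
    if it vanishes, [f] kills the frame, hence everything. *)
Lemma inner_hom : inner (sform_hom hV hW).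
Proof.
have [s ps] := parseval_exists iV; have E := sform_homE ps.
split=> [a f g k|f g|f].
- rewrite !E mulr_sumr -big_split; apply: eq_bigr => e _.
  by rewrite add_lfunE scale_lfunE (inner_lin iW).
- rewrite !E rmorph_sum; apply: eq_bigr => e _; exact: inner_conj.
- move=> f_neq0; rewrite lt0r E sumr_ge0 ?andbT => [|e _]; last exact: inner_ge0.
  apply: contra f_neq0.
  rewrite psumr_eq0 => [/allP /= f0|e _]; last exact: inner_ge0.
  apply/eqP/lfunP => v; rewrite zero_lfunE [in LHS](ps v) linear_sum.
  rewrite big_seq big1 //= => e es.
  by rewrite linearZ /= (inner_eq0 iW (eqP (f0 e es))) scaler0.
Qed.

Lemma inner_sum : inner (sform_sum hV hW).
Proof.
split=> [a u v w|u v|[u v]]; rewrite /sform_sum /=.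
- by rewrite (inner_lin iV) (inner_lin iW) mulrDr addrACA.
- by rewrite rmorphD /= -(inner_conj iV) -(inner_conj iW).
- have [->|u_neq0] := eqVneq u 0; last first.
    by rewrite ltr_wpDr ?(inner_ge0 iW) ?(inner_gt0 iV).
  rewrite (inner0l iV) add0r => uv; apply: (inner_gt0 iW).
  by apply: contra uv => /eqP ->.
Qed.

End Adjoint.

Lemma inner_triv : inner (@sform_triv C).
Proof.
split=> [a u v w|u v|v v_neq0]; rewrite /sform_triv.
- by rewrite mulrDl -mulrA.
- by rewrite rmorphM /= conjCK mulrC.
- by rewrite mul_conjC_gt0.
Qed.

Lemma inner_tens (V W : vectType C) (hV : sform V) (hW : sform W) :
  inner hV -> inner hW -> inner (sform_tens hV hW).
Proof. by move=> iV iW; apply: inner_hom => //; apply: inner_hom inner_triv. Qed.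

Lemma inner_sub (V : vectType C) (h : sform V) (U : {vspace V}) :
  inner h -> inner (fun u v : subvs_of U => h (vsval u) (vsval v)).
Proof.
move=> ih; split=> [a u v w|u v|v v_neq0].
- by rewrite linearP /= (inner_lin ih).
- exact: inner_conj.
- by apply: (inner_gt0 ih); apply: contra v_neq0 => /eqP v0; apply/eqP/val_inj.
Qed.

Lemma tens_mapE (V V' W W' : vectType C) (a : 'Hom(V, V')) (b : 'Hom(W, W')) t l :
  tens_map a b t l = b (t (l \o a)%VF).
Proof. by rewrite lfunE /= /tens_fun !comp_lfunE lfunE. Qed.

Lemma diag_mapE (V V' W W' : vectType C) (a : 'Hom(V, V')) (b : 'Hom(W, W')) u :
  diag_map a b u = (a u.1, b u.2).
Proof. by rewrite lfunE. Qed.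

Lemma lker_zero (V W : vectType C) : lker (0 : 'Hom(V, W)) = fullv.
Proof. by apply/vspaceP => v; rewrite memvf memv_ker zero_lfunE eqxx. Qed.

End InnerProducts.

(** * The metrics on covectors, 2-forms and spinors at one point *)

Section Fibre.
Variables (R : realType) (h : herm4 R).
Local Notation C := R[i].

Lemma invmx_hg_tr : (invmx (hg h))^T = invmx (hg h).
Proof. by rewrite trmx_inv hg_sym. Qed.

Lemma hg_unit : hg h \in unitmx.
Proof.
rewrite -row_free_unit -kermx_eq0; apply/rowV0P => v /sub_kermxP vg.
apply/eqP/negPn/negP => /(hg_pos h).
by rewrite vg mul0mx mxE ltxx.
Qed.

Lemma invmx_hg_gt0 (v : 'rV[R]_4) : v != 0 -> 0 < (v *m invmx (hg h) *m v^T) 0 0.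
Proof.
move=> v_neq0; have : v *m invmx (hg h) != 0.
  by apply: contra v_neq0 => /eqP v0; rewrite -[v](mulmxKV hg_unit) v0 mul0mx.
move/(hg_pos h); rewrite trmx_mul invmx_hg_tr mulmxKV ?hg_unit //.
by rewrite mulmxA.
Qed.

Lemma giC_tr : (giC h)^T = giC h.
Proof. by rewrite /giC /toC map_trmx invmx_hg_tr. Qed.

Lemma cbar_toC m n (B : 'M[R]_(m, n)) : cbar (toC B) = toC B.
Proof. by apply/matrixP => i j; rewrite !mxE; exact: conjc_real. Qed.

Lemma cbarK m n : involutive (@cbar R m n).
Proof. by move=> B; apply/matrixP => i j; rewrite !mxE conjCK. Qed.

Lemma cov_ip_lin a (s t u : 'cV[C]_4) :
  cov_ip h (a *: s + t) u = a * cov_ip h s u + cov_ip h t u.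
Proof. by rewrite /cov_ip linearP /= !mulmxDl -!scalemxAl !mxE. Qed.

Lemma cov_ip_conj (s t : 'cV[C]_4) : cov_ip h s t = (cov_ip h t s)^*.
Proof.
transitivity (cbar (t^T *m giC h *m cbar s) 0 0); last by rewrite mxE.
have -> : cbar (t^T *m giC h *m cbar s) = (cbar t)^T *m giC h *m s.
  rewrite /cbar !map_mxM /= -map_trmx -!/(cbar _) cbarK.
  by rewrite /giC cbar_toC.
 transitivity ((s^T *m giC h *m cbar t)^T 0 0); first by rewrite [RHS]mxE.
by rewrite !trmx_mul trmxK giC_tr mulmxA.
Qed.

Lemma cov_ip_toC (a b : 'cV[R]_4) :
  cov_ip h (toC a) (toC b) = real_complex R ((a^T *m invmx (hg h) *m b) 0 0).
Proof. by rewrite /cov_ip cbar_toC /giC /toC map_trmx -!map_mxM mxE. Qed.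

(** Splitting [s] into real and imaginary parts [a] and [b], the cross terms cancel by symmetry of
    the real metric, and [q a + q b] remains. *)
Lemma cov_ip_gt0 (s : 'cV[C]_4) : s != 0 -> 0 < cov_ip h s s.
Proof.
pose a : 'cV[R]_4 := \col_i complex.Re (s i 0).
pose b : 'cV[R]_4 := \col_i complex.Im (s i 0).
have sE : s = 'i *: toC b + toC a.
  apply/matrixP => i j; rewrite !mxE ord1 addrC [LHS]complexE.
  by rewrite complexiE.
pose q (c : 'cV[R]_4) := (c^T *m invmx (hg h) *m c) 0 0.
have q_gt0 c : c != 0 -> 0 < q c.
  by move=> c0; rewrite /q -{2}[c]trmxK invmx_hg_gt0 // trmx_eq0.
have q_ge0 c : 0 <= q c.
  by have [->|/q_gt0/ltW//] := eqVneq c 0; rewrite /q mulmx0 mxE.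
have ba : cov_ip h (toC b) (toC a) = cov_ip h (toC a) (toC b).
  by rewrite [RHS]cov_ip_conj !cov_ip_toC; apply/esym/conjc_real.
have E : cov_ip h s s = real_complex R (q a + q b).
  have R1 c d : cov_ip h (toC c) (toC d) = (cov_ip h (toC c) (toC d))^*.
    by rewrite !cov_ip_toC; apply/esym/conjc_real.
  rewrite {1}sE cov_ip_lin [cov_ip h (toC b) s]cov_ip_conj.
  rewrite [cov_ip h (toC a) s]cov_ip_conj.
  rewrite sE !cov_ip_lin !rmorphD !rmorphM /= -!R1 conjCi ba.
  rewrite !cov_ip_toC -/(q a) -/(q b).
  rewrite mulrDr mulNr mulrN mulrA -expr2 sqrCi mulN1r opprK addrA.
  by rewrite mulNr addrK addrC.
move=> s_neq0; rewrite E ltcR.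
have [a0|/q_gt0 qa] := eqVneq a 0; last by rewrite ltr_wpDr.
have [b0|/q_gt0 qb] := eqVneq b 0; last by rewrite ltr_wpDl.
by case/eqP: s_neq0; rewrite sE a0 b0 /toC !map_mx0 scaler0 addr0.
Qed.

Lemma inner_cov : inner (cov_ip h : sform 'cV[C]_4).
Proof.
by split=> *; [apply: cov_ip_lin|apply: cov_ip_conj|apply: cov_ip_gt0].
Qed.

(** The frame expansion as a resolution of the identity matrix, ready to be inserted into traces and
    products. *)
Lemma parseval_cov_mx (s : seq 'cV[C]_4) :
  (forall v, v = \sum_(e <- s) cov_ip h v e *: e) ->
  \sum_(e <- s) e *m (cbar e)^T *m giC h = 1%:M.
Proof.
move=> ps; apply/matrixP => i j.
transitivity ((\sum_(e <- s) cov_ip h (delta_mx j 0) e *: e) i 0); last first.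
  by rewrite -ps !mxE eqxx andbT.
rewrite !summxE; apply: eq_bigr => e _; rewrite [RHS]mxE -mulmxA mxE big_ord1 mulrC.
congr (_ * _); transitivity ((((cbar e)^T *m giC h)^T) j 0).
  by rewrite [RHS]mxE.
rewrite trmx_mul trmxK giC_tr /cov_ip trmx_delta -mulmxA -rowE.
by rewrite [RHS]mxE.
Qed.

Lemma cbar_giC : cbar (giC h) = giC h.
Proof. exact: cbar_toC. Qed.

Lemma cbarM m n p (A : 'M[C]_(m, n)) (B : 'M[C]_(n, p)) :
  cbar (A *m B) = cbar A *m cbar B.
Proof. exact: map_mxM. Qed.

(** Inserting the resolution of the identity into the trace and cycling turns the metric on forms
    into a sum of covector products, from which positivity is inherited. *)
Lemma form_ip_parseval (s : seq 'cV[C]_4) :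
  (forall v, v = \sum_(e <- s) cov_ip h v e *: e) ->
  forall w t, form_ip h w t =
    2^-1 * \sum_(e <- s) cov_ip h (w *m giC h *m cbar e) (t *m giC h *m cbar e).
Proof.
move=> /parseval_cov_mx ps w t; rewrite /form_ip; congr (_ * _).
rewrite -[X in \tr X]mulmx1 -ps mulmx_sumr linear_sum; apply: eq_bigr => e _ /=.
rewrite -[e *m _ *m _]mulmxA mulmxA mxtrace_mulC trace_mx11 /cov_ip.
by rewrite !cbarM cbarK cbar_giC !trmx_mul giC_tr !mulmxA.
Qed.

Lemma inner_form : inner (form_ip h : sform 'M[C]_(4, 4)).
Proof.
have [s ps] := parseval_exists inner_cov; have E := form_ip_parseval ps.
have half_gt0 : 0 < 2^-1 :> C by rewrite invr_gt0 ltr0n.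
split=> [a u v w|u v|w w_neq0].
- rewrite !E mulrCA -mulrDr; congr (_ * _); rewrite mulr_sumr -big_split.
  by apply: eq_bigr => e _ /=; rewrite -cov_ip_lin !mulmxDl -!scalemxAl.
- rewrite !E rmorphM fmorphV rmorph_nat rmorph_sum /=; congr (_ * _).
  by apply: eq_bigr => e _; rewrite -cov_ip_conj.
- have ge0 := inner_ge0 inner_cov.
  rewrite E pmulr_rgt0 // lt0r sumr_ge0 ?andbT => [|e _]; last exact: ge0.
  apply: contra w_neq0; rewrite psumr_eq0 => [/allP /= w0|e _]; last exact: ge0.
  (* The transposed resolution writes [w] as a sum whose terms have the factors
     [w *m giC h *m cbar e], all of norm zero here. *)
  have := congr1 trmx (parseval_cov_mx ps); rewrite trmx1 raddf_sum /= => P1.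
  rewrite -[w]mulmx1 -P1 mulmx_sumr big_seq big1 // => e es.
  rewrite !trmx_mul giC_tr trmxK !mulmxA.
  by rewrite (inner_eq0 inner_cov (eqP (w0 e es))) !mul0mx.
Qed.

Lemma inner_L10 : inner (@ip_L10 R h).
Proof. exact: inner_sub inner_cov. Qed.

Lemma inner_Wplus : inner (@ip_Wplus R h).
Proof. exact: inner_sum inner_L10 (inner_triv _). Qed.

Lemma inner_Wminus : inner (@ip_Wminus R h).
Proof. exact: inner_sub (inner_hom inner_L10 inner_L10). Qed.

Lemma inner_Splus : inner (@ip_Splus R h).
Proof. exact: inner_sum (inner_triv _) (inner_sub _ inner_form). Qed.

Lemma inner_Sminus : inner (@ip_Sminus R h).
Proof. exact: inner_sub inner_cov. Qed.

Lemma inner_Eplus : inner (@ip_Eplus R h).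
Proof.
exact: inner_sum (inner_tens inner_Splus inner_Wplus)
                 (inner_tens inner_Sminus inner_Wminus).
Qed.

Lemma inner_Eminus : inner (@ip_Eminus R h).
Proof.
exact: inner_sum (inner_tens inner_Splus inner_Wminus)
                 (inner_tens inner_Sminus inner_Wplus).
Qed.

(** The trace is nonzero on the identity, so its kernel in the 4-dimensional endomorphism space is
    proper. *)
Lemma dim_sl10 : (\dim (sl10 h) <= 3)%N.
Proof.
pose tr := linfun (fun f : 'End(subvs_of (L10 h)) => lftrace f : C^o).
have := limg_ker_dim tr fullv; rewrite capfv -/(sl10 h) dimvf.
have dimL : dim (subvs_of (L10 h)) = 2 by rewrite -dimvf dim_L10.
have -> : dim 'End(subvs_of (L10 h)) = 4.
  by rewrite -[LHS]/(dim (subvs_of (L10 h)) * dim (subvs_of (L10 h)))%N dimL.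
move=> E.
have : (0 < \dim (limg tr))%N.
  rewrite lt0n dimv_eq0; apply/eqP => tr0.
  have := memv_img tr (memvf \1%VF); rewrite tr0 memv0 lfunE /= lftrace_id.
  by rewrite pnatr_eq0.
by move: E; set a := \dim _; set b := \dim _; lia.
Qed.

(** * Vanishing and invertibility of [psi] *)

Section Psi.
Variables (eta : subvs_of (L20 h)) (alpha : subvs_of (L10 h)).

Lemma alpha_eta0r : eta = 0 -> alpha_eta eta alpha = 0.
Proof.
by move=> ->; apply/val_inj; rewrite /= /contract_cov mulmx0 trmx0.
Qed.

Lemma sharp0 : sharp h 0 = 0.
Proof. by rewrite /sharp /cbar map_mx0 mulmx0 trmx0. Qed.

Lemma alpha_eta0l : alpha = 0 -> alpha_eta eta alpha = 0.
Proof.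
by move=> ->; apply/val_inj; rewrite /= /contract_cov sharp0 mul0mx trmx0.
Qed.

Lemma psi_eq0 : alpha = 0 \/ eta = 0 -> psi eta alpha = 0.
Proof.
move=> ae0.
have ae : alpha_eta eta alpha = 0.
  by case: ae0 => [/alpha_eta0l|/alpha_eta0r].
apply/lfunP => w; apply/val_inj; rewrite zero_lfunE.
apply/lfunP => c; transitivity (psi_fun eta alpha w c); first by rewrite -psiE.
rewrite /psi_fun ae.
rewrite !(add_lfunE, opp_lfunE, scale_lfunE) !lfunE /= /rank1_fun sharp0 mul0mx.
by rewrite mxE scale0r (inner0r inner_cov) mulr0 scale0r subrr !scaler0 addr0.
Qed.

(** The columns of [eta] lie in the plane [L10]. If [alpha_eta] were zero, the metric dual of
    [alpha] would kill all these columns, though it does not kill [alpha]. *)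
Lemma alpha_eta_neq0 : alpha != 0 -> eta != 0 -> alpha_eta eta alpha != 0.
Proof.
move=> alpha_neq0; apply: contra => /eqP ae.
pose v := sharp h (vsval alpha); pose w := vsval eta.
have /memv_capP[/L_eigP wT /L_eigP wJ] := valP eta.
rewrite lfunE /= scaleN1r -/w in wT; rewrite lfunE /= -/w in wJ.
have vw : v *m w = 0.
  by apply: trmx_inj; rewrite trmx0; exact: (congr1 vsval ae).
have va : (v *m vsval alpha) 0 0 != 0.
  by rewrite sharpE lt0r_neq0 // (inner_gt0 inner_L10 alpha_neq0).
have colL j : col j w \in L10 h.
  by apply/L_eigP; rewrite lfunE /= colE mulmxA wJ -scalemxAl.
have diag i : w i i = 0.
  have /eqP := congr1 (fun B : 'M[C]_(4, 4) => B i i) wT; rewrite !mxE -addr_eq0.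
  by rewrite -mulr2n mulrn_eq0 => /eqP.
have tr i j : w j i = - w i j.
  by have := congr1 (fun B : 'M[C]_(4, 4) => B i j) wT; rewrite !mxE.
apply/eqP/val_inj/matrixP => i j; rewrite -/w [RHS]mxE; apply/eqP/negPn/negP => wij.
(* [w] vanishes at (i, i) and (j, j) but not at (i, j), and [v] kills the columns
   of [w] but not [alpha]: three independent vectors in the plane [L10]. *)
pose X := [tuple of [:: vsval alpha; col i w; col j w]].
have XL : (<<X>> <= L10 h)%VS.
  apply/span_subvP => x; rewrite !inE => /or3P[]/eqP-> //; exact: valP.
have freeX : free X.
  apply/freeP => k; rewrite !big_ord_recl big_ord0 addr0 /= => kX.
  (* Pairing with [v] isolates the first coefficient; rows [j] and [i] then isolate the other two,
     because the diagonal of [w] vanishes. *)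
  have k0 : k ord0 = 0.
    have := congr1 (fun B => (v *m B) 0 0) kX.
    rewrite !mulmxDr -!scalemxAr !colE !(mulmxA v) vw !mul0mx !scaler0 !addr0 mulmx0.
    by rewrite mxE [RHS]mxE => /eqP; rewrite mulf_eq0 (negPf va) orbF => /eqP.
  have k1 : k (lift ord0 ord0) = 0.
    have := congr1 (fun B : 'cV[C]_4 => B j 0) kX.
    rewrite k0 !mxE diag tr mul0r add0r mulr0 addr0 => /eqP.
    by rewrite mulf_eq0 oppr_eq0 (negPf wij) orbF => /eqP.
  have k2 : k (lift ord0 (lift ord0 ord0)) = 0.
    have := congr1 (fun B : 'cV[C]_4 => B i 0) kX.
    rewrite k0 k1 !mxE !mul0r !add0r => /eqP.
    by rewrite mulf_eq0 (negPf wij) orbF => /eqP.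
  move=> l; case: (unliftP ord0 l) => [l' ->|-> //].
  case: (unliftP ord0 l') => [l'' ->|-> //].
  by rewrite (ord1 l'').
have := dimvS XL; rewrite (eqP (freeX : \dim _ == _)) /=.
suff -> : \dim (L10 h) = 2 by [].
by rewrite -(dim_L10 h) dimvf.
Qed.

Lemma psi_inj : alpha != 0 -> eta != 0 -> lker (psi eta alpha) = 0%VS.
Proof.
move=> alpha_neq0 eta_neq0; have ae_neq0 := alpha_eta_neq0 alpha_neq0 eta_neq0.
pose ae := alpha_eta eta alpha; pose n := ip_L10 ae ae.
have n_neq0 : n != 0 by rewrite lt0r_neq0 // (inner_gt0 inner_L10).
have psi_at w c : vsval (psi eta alpha w) c = ip_L10 c ae *: w.1
    - (2^-1 * ip_L10 w.1 ae) *: c + w.2 *: (ip_L10 c alpha *: ae).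
  rewrite psiE /psi_fun !(add_lfunE, opp_lfunE, scale_lfunE) !lfunE /= /rank1_fun.
  by rewrite !sharpE.
have ae_alpha : ip_L10 ae alpha = 0.
  (* The product is [eta] evaluated twice on the dual of [alpha], up to sign, and [eta] is
     alternating. *)
  by rewrite /ip_L10 -sharpE; exact: contract_self.
apply/eqP; rewrite -subv0; apply/subvP => w; rewrite memv_ker memv0 => /eqP w0.
have {}psi_at c : 0 = ip_L10 c ae *: w.1
    - (2^-1 * ip_L10 w.1 ae) *: c + w.2 *: (ip_L10 c alpha *: ae).
  by rewrite -psi_at w0 zero_lfunE.
have w1E : n *: w.1 = (2^-1 * ip_L10 w.1 ae) *: ae.
  apply/esym/eqP; rewrite -subr_eq0 -oppr_eq0 opprB; apply/eqP.
  by have := psi_at ae; rewrite ae_alpha scale0r scaler0 addr0 => <-.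
have w1ae : ip_L10 w.1 ae = 0.
  have := congr1 (fun v => ip_L10 v ae) w1E.
  rewrite !(innerZl inner_L10) -/n mulrC => /(mulIf n_neq0) half.
  have : ip_L10 w.1 ae *+ 2 = ip_L10 w.1 ae.
    by rewrite -mulr_natl {1}half mulVKf ?pnatr_eq0.
  by move/eqP; rewrite mulr2n -subr_eq0 addrK => /eqP.
have w1 : w.1 = 0.
  by apply/eqP; move/eqP: w1E; rewrite w1ae mulr0 scale0r scaler_eq0 (negPf n_neq0).
have w2 : w.2 = 0.
  have /esym/eqP := psi_at alpha.
  rewrite w1ae w1 mulr0 scaler0 scale0r subrr add0r scalerA scaler_eq0.
  rewrite (negPf ae_neq0) orbF mulf_eq0 [ip_L10 _ _ == 0]negbTE ?orbF => [/eqP //|].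
  by rewrite lt0r_neq0 // (inner_gt0 inner_L10).
by rewrite [w]surjective_pairing w1 w2.
Qed.

Lemma psi_surj : alpha != 0 -> eta != 0 -> limg (psi eta alpha) = fullv.
Proof.
move=> alpha_neq0 eta_neq0; apply/eqP; rewrite eqEdim subvf /=.
have := limg_ker_dim (psi eta alpha) fullv.
rewrite psi_inj // capv0 dimv0 add0n => ->.
(* The image has the dimension 2 + 1 of [Wplus], and the target has dimension at most 3. *)
rewrite !dimvf; apply: leq_trans dim_sl10 _.
by rewrite -[dim _]/(dim (subvs_of (L10 h)) + 1)%N -dimvf dim_L10.
Qed.

End Psi.

(** * From [psi] to the perturbation *)

Section Perturbation.
Variable f : 'Hom(Wplus h, Wminus h).

Lemma perturbation0 : f = 0 -> perturbation f = 0.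
Proof.
move=> ->; apply/lfunP => u; rewrite diag_mapE zero_lfunE (adj0 inner_Wplus inner_Wminus).
by congr (_, _); apply/lfunP => l; rewrite tens_mapE !zero_lfunE.
Qed.

(** The two blocks need injectivity of [f] and of its adjoint. The latter comes from surjectivity:
    if the adjoint kills [w = f v], the square norm of [w] is the product of [v] with 0. *)
Lemma perturbation_inj :
  lker f = 0%VS -> limg f = fullv -> lker (perturbation f) = 0%VS.
Proof.
move=> f_inj f_surj; apply/eqP; rewrite -subv0; apply/subvP => u.
rewrite memv_ker memv0 diag_mapE => /eqP [u1 u2].
have f_eq0 w : f w = 0 -> w = 0.
  by move/eqP; rewrite -memv_ker f_inj memv0 => /eqP.
have adj_eq0 w : adj (@ip_Wplus R h) (@ip_Wminus R h) f w = 0 -> w = 0.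
  move=> w0; have := memvf w; rewrite -f_surj => /memv_imgP [v _ wE].
  apply: (inner_eq0 inner_Wminus); rewrite {1}wE (adjP inner_Wplus inner_Wminus) w0.
  exact: (inner0r inner_Wplus).
rewrite [u]surjective_pairing; apply/eqP; congr (_, _); apply/lfunP => l;
  rewrite zero_lfunE.
- apply: f_eq0; have := congr1 (fun k => fun_of_lfun k l) u1.
  by rewrite tens_mapE zero_lfunE comp_lfun1r.
(* Evaluation at [- l] compensates the sign of the chirality operator on negative spinors. *)
- apply: adj_eq0; have := congr1 (fun k => fun_of_lfun k (- l)) u2.
  by rewrite tens_mapE zero_lfunE comp_lfunNr comp_lfun1r opprK.
Qed.

End Perturbation.

(** A zero map has a nonzero kernel only on a nonzero space. The trivial lines in [Splus] and
    [Wplus] make the dimension positive, whatever the rank of [L02]. *)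
Lemma Eplus_neq0 : fullv != 0%VS :> {vspace Eplus h}.
Proof.
rewrite -dimv_eq0 dimvf -lt0n.
rewrite -[dim _]/(((dim C^o + dim (subvs_of (L02 h))) * dim C^o *
                   (dim (subvs_of (L10 h)) + dim C^o) +
                   dim (tens (Sminus h) (Wminus h)))%N).
by rewrite -[dim C^o]/1%N muln1 addn1 add1n mulSn addSn.
Qed.

End Fibre.

(** * From the fibres to the manifold *)

Theorem lemma2p5 (R : realType) (M : topologicalType)
    (hausdorff_M : hausdorff_space M) (compact_M : compact [set: M])
    (A : smooth_atlas R M) (H : almost_hermitian A)
    (C : set M) (curve_C : J_holomorphic_curve H C)
    (canonical_C : represents_canonical_class H C)
    (eta : section20 H) (smooth_eta : smooth20 eta)
    (transverse_eta : transverse20 eta) (zero_eta : [set p | eta p = 0] = C)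
    (alpha : section10 H) (smooth_alpha : smooth10 alpha)
    (transverse_alpha : transverse10 alpha) :
  let Z_alpha := [set p | alpha p = 0] in
  let Z_A := singular_set eta alpha in
  [/\ forall p, (~` (Z_alpha `|` C)) p ->
        lker (psi_at eta alpha p) = 0%VS /\
        limg (psi_at eta alpha p) = fullv,
      forall p, (Z_alpha `|` C) p -> psi_at eta alpha p = 0,
      Z_A = Z_alpha `|` C,
      forall p, Z_A p -> A_at eta alpha p = 0 &
      forall p, Z_A p ->
        lker (A_at eta alpha p) = fullv /\
        lker (A_adj_at eta alpha p) = fullv].
Proof.
(* With [C] replaced by the zero set of [eta], every claim becomes a statement about one fibre. *)
move=> Z_alpha Z_A; rewrite -zero_eta.
have psi0 p : (Z_alpha `|` [set p | eta p = 0]) p -> psi_at eta alpha p = 0.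
  exact: psi_eq0.
have psi_iso p : (~` (Z_alpha `|` [set p | eta p = 0])) p ->
    lker (psi_at eta alpha p) = 0%VS /\ limg (psi_at eta alpha p) = fullv.
  move=> /not_orP [/eqP a0 /eqP e0].
  by split; [apply: psi_inj|apply: psi_surj].
have ZE : Z_A = Z_alpha `|` [set p | eta p = 0].
  apply/seteqP; split => p.
    move=> Ap; apply: contrapT => /psi_iso [inj surj].
    by move/eqP: Ap; apply; exact: perturbation_inj.
  move=> /psi0 p0; rewrite /Z_A /singular_set /= /A_at p0 perturbation0 // lker_zero.
  exact: Eplus_neq0.
have A0 p : Z_A p -> A_at eta alpha p = 0.
  by rewrite ZE => /psi0 /perturbation0.
split=> // p /A0 pA; rewrite /A_adj_at pA.
by rewrite (adj0 (inner_Eplus _) (inner_Eminus _)) !lker_zero.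
Qed.
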